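(* Let $\pi_\theta(\cdot\mid x_{<t})$ be the distribution over thoughts given a context $x_{<t}$, let $p_\theta(\cdot\mid x_{<t},c)$ be the reasoned predictor of the next token given the context and a thought $c$, and let $\bar p_\phi(\cdot\mid x_{<t})$ be the no-think baseline predictor. Define the collapsed predictor $$\tilde p_\theta(x\mid x_{<t})=\mathbb{E}_{z_t\sim\pi_\theta(\cdot\mid x_{<t})}\big[p_\theta(x\mid x_{<t},z_t)\big].$$ Then for any context $x_{<t}$ and any realized next token $x_t$, $$\mathbb{E}_{c_t\sim\pi_\theta(\cdot\mid x_{<t})}\big[\log p_\theta(x_t\mid x_{<t},c_t)\big]\;\le\;\log\tilde p_\theta(x_t\mid x_{<t}).$$ Moreover, letting $r(c_t)=\log p_\theta(x_t\mid x_{<t},c_t)-\log\bar p_\phi(x_t\mid x_{<t})$ and $$J(\theta)=\mathbb{E}_{(x_{<t},x_t)\sim\mathcal{D}}\;\mathbb{E}_{c_t\sim\pi_\theta(\cdot\mid x_{<t})}\big[r(c_t)\big],$$ one has $$J(\theta)\;\le\;\mathbb{E}_{(x_{<t},x_t)\sim\mathcal{D}}\left[\log\frac{\tilde p_\theta(x_t\mid x_{<t})}{\bar p_\phi(x_t\mid x_{<t})}\right].$$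
   Context: Let $V$ be a finite vocabulary of tokens. A context $x_{<t}$ is a finite sequence of tokens and a thought is a finite sequence of tokens (so the set of thoughts is countable). For each context $x_{<t}$, $\pi_\theta(\cdot\mid x_{<t})$ is a probability distribution on thoughts. For each context $x_{<t}$ and thought $c$, $p_\theta(\cdot\mid x_{<t},c)$ and $\bar p_\phi(\cdot\mid x_{<t})$ are probability distributions on $V$ assigning strictly positive probability to every token. $\mathcal{D}$ is a probability distribution (the data distribution) over pairs $(x_{<t},x_t)$ of a context and its next token. The thought $c_t$ is sampled from $\pi_\theta(\cdot\mid x_{<t})$ given only the context, i.e. it is conditionally independent of $x_t$ given $x_{<t}$. All random variables whose expectations are written are assumed integrable. *)

(* Defs.v *)
From HB Require Import structures.
From mathcomp Require Import all_boot all_order all_algebra.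
From mathcomp Require Import all_classical all_reals all_analysis.

Set Implicit Arguments.
Unset Strict Implicit.
Unset Printing Implicit Defensive.

Import Order.TTheory GRing.Theory Num.Theory.

Local Open Scope classical_set_scope.
Local Open Scope ring_scope.
Local Open Scope ereal_scope.

(* A countable type with the discrete sigma-algebra, so that a probability
   measure on it is just a probability distribution on T. MathComp-Analysis makes measurable
   types pointed; the choice of the point x0 plays no other role. *)
Definition discrete (T : countType) (x0 : T) : Type := T.

Section discrete_instances.
Context (T : countType) (x0 : T).

HB.instance Definition _ := Countable.on (discrete x0).
HB.instance Definition _ := isPointed.Build (discrete x0) x0.
HB.instance Definition _ := @isMeasurable.Build default_measure_display
  (discrete x0) (@discrete_measurable (discrete x0))
  (@discrete_measurable0 (discrete x0)) (@discrete_measurableC (discrete x0))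
  (@discrete_measurableU (discrete x0)).

End discrete_instances.

Notation context V := (seq V).

Notation thought V := (discrete ([::] : seq V)).

(* Pairs (context, next token); x0 only witnesses that V is nonempty. *)
Notation sample x0 := (discrete ([::] : seq _, x0)).

Definition pos_distr (R : realType) (V : finType) (f : V -> R) : Prop :=
  (forall x, (0 < f x)%R) /\ (\sum_(x : V) f x = 1)%R.

Section predictors.
Context (R : realType) (V : finType).
Variables (pi : context V -> probability (thought V) R)
          (p : context V -> thought V -> V -> R)
          (pbar : context V -> V -> R).

(* The expectation is finite as soon as p takes values in [0, 1], hence [fine]
   loses nothing. *)
Definition collapsed (s : context V) (x : V) : R :=
  fine 'E_(pi s)[fun z => p s z x].

Definition reward (s : context V) (x : V) (c : thought V) : R :=
  (ln (p s c x) - ln (pbar s x))%R.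

(* The thought is drawn from pi given the context alone, so it is conditionally
   independent of the next token and the expectation is an iterated integral. *)
Definition objective (x0 : V) (D : probability (sample x0) R) : \bar R :=
  \int[D]_sx 'E_(pi sx.1)[reward sx.1 sx.2].

End predictors.

(* Main.v *)
Require Import Defs.
From HB Require Import structures.
From mathcomp Require Import all_boot all_order all_algebra.
From mathcomp Require Import all_classical all_reals all_analysis.
From mathcomp Require Import measurable_realfun lra.

Import Order.TTheory GRing.Theory Num.Theory.

Local Open Scope classical_set_scope.
Local Open Scope ring_scope.
Local Open Scope ereal_scope.

(** Both claims are Jensen's inequality for the concave [ln] under the law of the thought, with
    context and token fixed. Jensen ([expectation_ln_le]) comes from integrating a tangent line of
    [ln] and then choosing the point of tangency. For the objective it is applied to [p / pbar] at
    almost every sample, and [ae_le_integral] carries the bound through the integral over [D]. *)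

(** This is the tangent to [ln] at [expR t]; it is [1 + u <= expR u] at [u = ln y - t]. The
    parameter [t] stays free so that it can be chosen after integration. *)
Lemma ln_le_tangent (R : realType) (t y : R) :
  (0 < y)%R -> (ln y <= y * expR (- t) + (t - 1))%R.
Proof.
move=> y0; have := expR_ge1Dx (ln y - t).
by rewrite expRD lnK ?posrE//; lra.
Qed.

(* Integrate the tangent bound and take t := ln E[X]. The degenerate case
   E[X] = 0 is excluded by t := E[ln X], for which the bound reads t <= t - 1. *)
Lemma expectation_ln_le d (T : measurableType d) (R : realType)
    (P : probability T R) (X : T -> R) :
    (forall c, (0 < X c)%R) ->
    X \in Lfun P 1 -> (fun c => ln (X c)) \in Lfun P 1 ->
  'E_P[fun c => ln (X c)] <= (ln (fine 'E_P[X]))%:E.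
Proof.
move=> X0 iX ilnX; pose m := fine 'E_P[X]; pose e := fine 'E_P[fun c => ln (X c)].
have fX : 'E_P[X] \is a fin_num by exact: expectation_fin_num.
have flnX : 'E_P[fun c => ln (X c)] \is a fin_num by exact: expectation_fin_num.
have tangent t : (e <= m * expR (- t) + (t - 1))%R.
  rewrite -lee_fin EFinD EFinM [_ * (expR (- t))%:E]muleC !fineK//.
  have iZ : (expR (- t) \o* X)%R \in Lfun P 1 by exact: Lfun_scale.
  have ic : cst (t - 1)%R \in Lfun P 1 by exact: Lfun_cst.
  have /Lfun1_integrable iY : (expR (- t) \o* X \+ cst (t - 1))%R \in Lfun P 1.
    exact: rpredD.
  (* By linearity, and since [P] has total mass 1, the right-hand side is the expectation of the
     tangent line evaluated at [X]. *)
  rewrite -expectationZl// -(expectation_cst P (t - 1)%R) -expectationD// unlock.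
  apply: le_integral => //; first by move/Lfun1_integrable : ilnX.
  by move=> c _; rewrite lee_fin/= ln_le_tangent.
have m0 : (0 <= m)%R by apply/fine_ge0/expectation_ge0 => c; exact/ltW.
rewrite -(fineK flnX) -/e -/m lee_fin.
move: m0; rewrite le_eqVlt => /predU1P[m0|m0].
  by have := tangent e; rewrite -m0; lra.
by have := tangent (ln m); rewrite expRN lnK ?posrE// divff ?gt_eqF//; lra.
Qed.

(** Where [f <= g], the positive parts satisfy the same inequality and the negative parts the
    reverse one, which reduces the claim to nonnegative functions. The almost-everywhere form is
    needed because the reward is assumed integrable only for [D]-almost every sample. *)
Lemma ae_le_integral d (T : measurableType d) (R : realType)
    (mu : {measure set T -> \bar R}) (D : set T) (f g : T -> \bar R) :
    measurable D -> mu.-integrable D f -> mu.-integrable D g ->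
    {ae mu, forall x, D x -> f x <= g x} ->
  \int[mu]_(x in D) f x <= \int[mu]_(x in D) g x.
Proof.
move=> mD /[dup] intf /measurable_int mf /[dup] intg /measurable_int mg fg.
rewrite (integralE _ _ f) (integralE _ _ g); apply: leeB.
- apply: ae_ge0_le_integral => //; [exact: measurable_funepos..|].
  apply: filterS fg => x /[apply] fgx; rewrite !funeposE.
  by rewrite ge_max !le_max fgx lexx !orbT.
- apply: ae_ge0_le_integral => //; [exact: measurable_funeneg..|].
  apply: filterS fg => x /[apply] fgx; rewrite !funenegE.
  by rewrite ge_max !le_max leeN2 fgx lexx !orbT.
Qed.

Section positive_distributions.
Context {R : realType} {V : finType}.

Lemma pos_distr_le1 (f : V -> R) x : pos_distr f -> (f x <= 1)%R.
Proof.
move=> [f0 <-]; rewrite (bigD1 x)//= lerDl.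
by apply: sumr_ge0 => y _; exact/ltW.
Qed.

(** On a discrete space every function is measurable, and this one is bounded by 1 under a finite
    measure. Hence the expectation inside [collapsed] is finite. *)
Lemma pos_distr_Lfun1 (P : probability (thought V) R)
    (f : thought V -> V -> R) x :
  (forall c, pos_distr (f c)) -> f ^~ x \in Lfun P 1.
Proof.
move=> fV; apply/Lfun1_integrable/measurable_bounded_integrable => //.
  by rewrite -ge0_fin_numE// fin_num_measure.
exists 1%R; split => // M M1 c _ /=; have [fc0 _] := fV c.
rewrite ger0_norm ?(ltW (fc0 _))//.
exact: le_trans (pos_distr_le1 _ _ (fV c)) (ltW M1).
Qed.

End positive_distributions.

Theorem proposition2 (R : realType) (V : finType) (x0 : V)
    (pi : context V -> probability (thought V) R)
    (p : context V -> thought V -> V -> R)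
    (pbar : context V -> V -> R)
    (D : probability (sample x0) R)
    (p_distr : forall (s : context V) (c : thought V), pos_distr (p s c))
    (pbar_distr : forall s : context V, pos_distr (pbar s)) :
  (forall (s : context V) (x : V),
     (pi s).-integrable setT (fun c => (ln (p s c x))%:E) ->
     'E_(pi s)[fun c => ln (p s c x)] <= (ln (collapsed pi p s x))%:E)
  /\
  ({ae D, forall sx : sample x0,
      (pi sx.1).-integrable setT
        (fun c => (reward p pbar sx.1 sx.2 c)%:E)} ->
   D.-integrable setT
     (fun sx => 'E_(pi sx.1)[reward p pbar sx.1 sx.2]) ->
   D.-integrable setT
     (fun sx => (ln (collapsed pi p sx.1 sx.2 / pbar sx.1 sx.2))%:E) ->
   objective pi p pbar D <=
     'E_D[fun sx => ln (collapsed pi p sx.1 sx.2 / pbar sx.1 sx.2)]).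
Proof.
have ip s x : p s ^~ x \in Lfun (pi s) 1.
  exact: pos_distr_Lfun1.
have p0 s c x : (0 < p s c x)%R by have [] := p_distr s c.
split=> [s x /Lfun1_integrable ilnp|ir iE iln].
  rewrite /collapsed; exact: expectation_ln_le.
rewrite /objective [in leRHS]unlock; apply: ae_le_integral => //.
apply: filterS ir => -[s x]/= ir _.
have pbar0 : (0 < pbar s x)%R by have [] := pbar_distr s.
(* The baseline does not depend on the thought, so the reward is the [ln] of a rescaled [p]. Jensen
   then needs exactly the integrability of the reward given by [ir]. *)
have rE : reward p pbar s x = fun c => ln (((pbar s x)^-1 \o* p s ^~ x) c)%R.
  by apply/funext => c; rewrite /reward/= ln_div ?posrE.
have -> : (collapsed pi p s x / pbar s x)%R
    = fine 'E_(pi s)[(pbar s x)^-1 \o* p s ^~ x]%R.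
  by rewrite expectationZl// fineM// ?expectation_fin_num// mulrC.
rewrite rE in ir *; move/Lfun1_integrable in ir.
apply: expectation_ln_le => //; last exact: Lfun_scale.
by move=> c /=; rewrite divr_gt0.
Qed.
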